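(* Let $\Phi(t)$ be a smooth one-parameter family of $\operatorname{Spin}(7)$-structures on the smooth $8$-manifold $M$, with associated metrics $g=g(t)$, satisfying $$\frac{\partial}{\partial t}\Phi_{ijkl} = A_{im} g^{mn}\Phi_{njkl} + A_{jm} g^{mn}\Phi_{inkl} + A_{km} g^{mn}\Phi_{ijnl} + A_{lm} g^{mn}\Phi_{ijkn},$$ where $A_{ij}=h_{ij}+X_{ij}$, $h=h(t)$ is a symmetric $2$-tensor and $X=X(t)\in\Omega^2_7$ (with respect to $\Phi(t)$). Then the metric evolves by $$\frac{\partial}{\partial t} g_{ij} = 2\, h_{ij}.$$
   Context: A $\operatorname{Spin}(7)$-structure on a smooth $8$-manifold $M$ (not necessarily compact) is a smooth $4$-form $\Phi$ such that at each point there is a basis $e^1,\dots,e^8$ of the cotangent space in which $\Phi = -\big(e^{1234}+e^{1256}+e^{1278}+e^{3456}+e^{3478}+e^{5678}+e^{1357}-e^{1368}-e^{1458}-e^{1467}-e^{2358}-e^{2367}-e^{2457}+e^{2468}\big)$, where $e^{ijkl}=e^i\wedge e^j\wedge e^k\wedge e^l$. It determines a Riemannian metric $g=g_\Phi$ and an orientation, for which such a basis is oriented orthonormal; then $\ast\Phi=\Phi$. In local coordinates $\Phi=\frac1{24}\Phi_{ijkl}dx^i\wedge dx^j\wedge dx^k\wedge dx^l$, and repeated indices are summed. $\Omega^2_7=\{\beta\in\Omega^2: \ast(\Phi\wedge\beta)=-3\beta\}$, a rank $7$ subbundle of the bundle of $2$-forms. *)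

(* Defs.v *)
From HB Require Import structures.
From mathcomp Require Import all_boot all_order all_algebra all_fingroup.
From mathcomp Require Import all_classical all_reals all_analysis.
Set Implicit Arguments.
Unset Strict Implicit.
Unset Printing Implicit Defensive.
Import Order.TTheory GRing.Theory Num.Theory.
Import numFieldNormedType.Exports.
Local Open Scope classical_set_scope.
Local Open Scope ring_scope.

Section Smoothness.
Context {R : realType} {n : nat}.

Fixpoint Ck_on_open (k : nat) (O : set 'rV[R]_n) (f : 'rV[R]_n -> R) : Prop :=
  {in O, continuous f} /\
  (if k is k'.+1 then
     forall i : 'I_n,
       (forall x, O x -> derivable f x (delta_mx 0 i)) /\
       Ck_on_open k' O (fun x => 'D_(delta_mx 0 i) f x)
   else True).

(* [D] need not be open: on a set such as [0, T) x U, smooth means locally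
   extendable to a smooth function on an open set. *)
Definition smooth_on (D : set 'rV[R]_n) (f : 'rV[R]_n -> R) : Prop :=
  forall x, D x -> exists (O : set 'rV[R]_n) (f' : 'rV[R]_n -> R),
    [/\ open O, O x, forall k, Ck_on_open k O f' &
        forall y, D y -> O y -> f y = f' y].

End Smoothness.

(* One-sided at an endpoint of the interval [J] that belongs to [J]. *)
Definition has_deriv_within {R : realType} (J : set R) (f : R -> R) (t l : R)
    : Prop :=
  (s - t)^-1 * (f s - f t) @[s --> within J t^'] --> l.

Record chart (R : realType) (n : nat) (M : topologicalType) := Chart {
  chart_dom : set M;
  chart_map : M -> 'rV[R]_n;
  chart_inv : 'rV[R]_n -> M;
  chart_dom_open : open chart_dom;
  chart_img_open : open (chart_map @` chart_dom);
  chart_mapK : forall p, chart_dom p -> chart_inv (chart_map p) = p;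
  chart_map_cont : {within chart_dom, continuous chart_map};
  chart_inv_cont : {within chart_map @` chart_dom, continuous chart_inv}
}.

Definition transition (R : realType) (n : nat) (M : topologicalType)
    (a b : chart R n M) (x : 'rV[R]_n) : 'rV[R]_n :=
  chart_map b (chart_inv a x).

Record smooth_manifold (R : realType) (n : nat) := SmoothManifold {
  points :> topologicalType;
  points_hausdorff : hausdorff_space points;
  points_second_countable : @second_countable points;
  atlas_index : Type;
  atlas : atlas_index -> chart R n points;
  atlas_cover : forall p : points, exists a, chart_dom (atlas a) p;
  atlas_compat : forall (a b : atlas_index) (j : 'I_n),
    smooth_on (chart_map (atlas a) @`
                 (chart_dom (atlas a) `&` chart_dom (atlas b)))
              (fun x => transition (atlas a) (atlas b) x 0 j)
}.

Section TensorFields.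
Context {R : realType} {n : nat} (M : smooth_manifold R n).

Definition comp4 (m : nat) := 'I_m -> 'I_m -> 'I_m -> 'I_m -> R.

(* Covariant tensor fields, given by their components in every chart of the
   atlas: [T a p] is the array of components at [p] in the coordinates of chart
   [a], meaningful when [p] lies in the domain of [a]. *)
Definition field2 := atlas_index M -> M -> 'M[R]_n.
Definition field4 := atlas_index M -> M -> comp4 n.

Notation dom a := (chart_dom (atlas a)).
Notation coord a := (chart_map (atlas a)).

(* [jacobian] acts on row vectors, so [chart_jacobian a b p i j] is the partial
   derivative of the [j]-th coordinate of [b] along the [i]-th one of [a]. *)
Definition chart_jacobian (a b : atlas_index M) (p : M) : 'M[R]_n :=
  jacobian (transition (atlas a) (atlas b)) (coord a p).

Definition tensorial2 (T : field2) : Prop :=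
  forall a b p, dom a p -> dom b p -> forall i j,
    let Jac := chart_jacobian a b p in
    T a p i j = \sum_(i' < n) \sum_(j' < n) Jac i i' * Jac j j' * T b p i' j'.

Definition tensorial4 (T : field4) : Prop :=
  forall a b p, dom a p -> dom b p -> forall i j k l,
    let Jac := chart_jacobian a b p in
    T a p i j k l =
      \sum_(i' < n) \sum_(j' < n) \sum_(k' < n) \sum_(l' < n)
        Jac i i' * Jac j j' * Jac k k' * Jac l l' * T b p i' j' k' l'.

Definition alternating4 (T : comp4 n) : Prop :=
  forall i j k l, [/\ T j i k l = - T i j k l, T i k j l = - T i j k l &
                      T i j l k = - T i j k l].

Definition smooth_tensor2 (T : field2) : Prop :=
  tensorial2 T /\
  forall a i j, smooth_on (coord a @` dom a)
                          (fun x => T a (chart_inv (atlas a) x) i j).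

(* The first coordinate of ['rV_(1 + n)] is the time parameter. *)
Definition smooth_family_4form (J : set R) (T : R -> field4) : Prop :=
  (forall t, J t -> tensorial4 (T t) /\
     forall a p, dom a p -> alternating4 (T t a p)) /\
  forall a i j k l,
    smooth_on [set z : 'rV[R]_(1 + n) |
                 J (lsubmx z 0 0) /\ (coord a @` dom a) (rsubmx z)]
      (fun z => T (lsubmx z 0 0) a (chart_inv (atlas a) (rsubmx z)) i j k l).

End TensorFields.

Section Spin7.
Context {R : realType}.

(* A coframe e^1, ..., e^8 is a matrix [E] whose row [a - 1] holds the
   components of e^a. [wedge4 E a b c d] are the components of e^{abcd}, with
   the 1-based labels [a b c d], normalized so that a form is
   (1/24) Phi_{ijkl} dx^i /\ dx^j /\ dx^k /\ dx^l. *)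
Definition wedge4 (E : 'M[R]_8) (a b c d : nat) : comp4 8 := fun i j k l =>
  \det (\matrix_(r < 4, s < 4)
          E (inord (nth 0%N [:: a; b; c; d] r).-1) (tnth [tuple i; j; k; l] s)).

Definition spin7_form (E : 'M[R]_8) : comp4 8 := fun i j k l =>
  - (  wedge4 E 1 2 3 4 i j k l
     + wedge4 E 1 2 5 6 i j k l
     + wedge4 E 1 2 7 8 i j k l
     + wedge4 E 3 4 5 6 i j k l
     + wedge4 E 3 4 7 8 i j k l
     + wedge4 E 5 6 7 8 i j k l
     + wedge4 E 1 3 5 7 i j k l
     - wedge4 E 1 3 6 8 i j k l
     - wedge4 E 1 4 5 8 i j k l
     - wedge4 E 1 4 6 7 i j k l
     - wedge4 E 2 3 5 8 i j k l
     - wedge4 E 2 3 6 7 i j k l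
     - wedge4 E 2 4 5 7 i j k l
     + wedge4 E 2 4 6 8 i j k l).

Definition adapted_coframe (Phi : comp4 8) (E : 'M[R]_8) : Prop :=
  E \in unitmx /\ Phi = spin7_form E.

(* The metric for which [E] is orthonormal: the sum of the e^a (x) e^a. *)
Definition coframe_metric (E : 'M[R]_8) : 'M[R]_8 := E^T *m E.

Definition spin7_metric (Phi : comp4 8) (g : 'M[R]_8) : Prop :=
  exists E, adapted_coframe Phi E /\ g = coframe_metric E.

Definition wedge_4_2 (Phi : comp4 8) (b : 'M[R]_8) (I : 6.-tuple 'I_8) : R :=
  ((4`! * 2`!)%N%:R)^-1 * \sum_(s : 'S_6)
    let k r := tnth I (s (inord r)) in
    (-1) ^+ s * Phi (k 0%N) (k 1%N) (k 2%N) (k 3%N) * b (k 4%N) (k 5%N).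

Definition levi_civita8 (I : 8.-tuple 'I_8) : R :=
  \det (\matrix_(r < 8, s < 8) (tnth I r == s)%:R).

(* Hodge star from 6-forms to 2-forms, for the metric [g] and the volume form
   v dx^1 /\ ... /\ dx^8; the convention is
   alpha /\ star beta = <alpha, beta> vol. *)
Definition hodge_6_2 (g : 'M[R]_8) (v : R) (w : 6.-tuple 'I_8 -> R) : 'M[R]_8 :=
  \matrix_(i, j) ((6`!)%:R^-1 *
    \sum_(I : 6.-tuple 'I_8) \sum_(K : 6.-tuple 'I_8)
      (\prod_(r < 6) invmx g (tnth I r) (tnth K r)) * w K *
      (v * levi_civita8 (cat_tuple I [tuple i; j]))).

(* The metric and volume form are those of an adapted coframe [E], which is
   oriented orthonormal, so the volume form is \det E dx^1 /\ ... /\ dx^8. *)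
Definition Omega2_7 (Phi : comp4 8) (b : 'M[R]_8) : Prop :=
  b^T = - b /\
  exists E, adapted_coframe Phi E /\
    hodge_6_2 (coframe_metric E) (\det E) (wedge_4_2 Phi b) = (-3) *: b.

Definition spin7_family (M : smooth_manifold R 8) (J : set R)
    (Phi : R -> field4 M) : Prop :=
  smooth_family_4form J Phi /\
  forall t a p, J t -> chart_dom (atlas a) p ->
    exists E, adapted_coframe (Phi t a p) E.

End Spin7.

(* Main.v *)
(* Read a 4-form Phi as a symmetric form P on pairs of indices. The model form
   satisfies phi^2 = 6 (1 - T) - 4 phi, with T the swap of the two indices of a
   pair, so P has an inverse W on bivectors, namely
   W = (1/6) Phi^sharp + (1/3) Lambda^2 g^-1. Since Phi^sharp is alternating, a
   cyclic sum (first Bianchi identity) removes it from W and leaves the 2 x 2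
   minors of G = g^-1. Hence these minors are differentiable in t, and if
   P' = C P + P C^T, where C = A G acts as a derivation on pairs, then
   W' = - (W C + C^T W), which turns into the linearization of the minors at G
   in the direction - (C^T G + G C). The entries of G are differentiable because
   a 3 x 3 principal submatrix of G is recovered from its minors after dividing
   by its determinant, the positive square root of the determinant of the second
   compound. The linearization of the minors is injective, so
   G' = - (C^T G + G C), that is, g' = A + A^T, and X is antisymmetric. *)

Require Import Defs.
From mathcomp Require Import all_boot all_order all_algebra.
From mathcomp Require Import all_classical all_reals all_analysis.
From mathcomp Require Import ring lra mxtens.
Import Order.TTheory GRing.Theory Num.Theory.
Import numFieldNormedType.Exports.
Local Open Scope classical_set_scope.
Local Open Scope ring_scope.

(** * The Spin(7) form as a sum of signed monomials in a coframe *)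

(* A pair [(e, s)] is the permutation [r |-> nth 0 s r] with its sign [e]. *)
Definition signed_perms4 : seq (int * seq nat) :=
  [:: (1%R, [:: 0; 1; 2; 3]); (-1%R, [:: 0; 1; 3; 2]);
      (-1%R, [:: 0; 2; 1; 3]); (1%R, [:: 0; 2; 3; 1]);
      (1%R, [:: 0; 3; 1; 2]); (-1%R, [:: 0; 3; 2; 1]);
      (-1%R, [:: 1; 0; 2; 3]); (1%R, [:: 1; 0; 3; 2]);
      (1%R, [:: 1; 2; 0; 3]); (-1%R, [:: 1; 2; 3; 0]);
      (-1%R, [:: 1; 3; 0; 2]); (1%R, [:: 1; 3; 2; 0]);
      (1%R, [:: 2; 0; 1; 3]); (-1%R, [:: 2; 0; 3; 1]);
      (-1%R, [:: 2; 1; 0; 3]); (1%R, [:: 2; 1; 3; 0]);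
      (1%R, [:: 2; 3; 0; 1]); (-1%R, [:: 2; 3; 1; 0]);
      (-1%R, [:: 3; 0; 1; 2]); (1%R, [:: 3; 0; 2; 1]);
      (1%R, [:: 3; 1; 0; 2]); (-1%R, [:: 3; 1; 2; 0]);
      (-1%R, [:: 3; 2; 0; 1]); (1%R, [:: 3; 2; 1; 0])]%N.

(** Indexing by naturals makes the minors of a Laplace expansion again a [nat_det], with [bump]
    skipping the deleted column, so the expansion can be iterated by rewriting. *)
Definition nat_det {K : comRingType} n (x : nat -> nat -> K) : K :=
  \det (\matrix_(i < n, j < n) x i j).

Lemma nat_detS (K : comRingType) n (x : nat -> nat -> K) :
  nat_det n.+1 x =
    \sum_(j < n.+1) x 0%N j *
      ((-1) ^+ j * nat_det n (fun i k => x i.+1 (bump j k))).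
Proof.
rewrite /nat_det (expand_det_row _ ord0); apply: eq_bigr => j _.
rewrite /cofactor !mxE add0n; congr (_ * (_ * \det _)).
by apply/matrixP => i k; rewrite !mxE.
Qed.

Lemma nat_det4 (K : comRingType) (x : nat -> nat -> K) :
  nat_det 4 x =
    \sum_(s <- signed_perms4) s.1%:~R *
      (x (nth 0%N s.2 0) 0%N * x (nth 0%N s.2 1) 1%N *
       x (nth 0%N s.2 2) 2%N * x (nth 0%N s.2 3) 3%N).
Proof.
rewrite /signed_perms4 !big_cons big_nil /=.
do 4! rewrite !nat_detS !big_ord_recl !big_ord0 /bump /=.
rewrite /nat_det !det_mx00.
ring.
Qed.

(* The labels of [spin7_form] shifted to 0-based coframe indices; the overall
   minus sign is absorbed in the signs. *)
Definition spin7_planes : seq (int * seq nat) :=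
  [:: (-1%R, [:: 0; 1; 2; 3]); (-1%R, [:: 0; 1; 4; 5]);
      (-1%R, [:: 0; 1; 6; 7]); (-1%R, [:: 2; 3; 4; 5]);
      (-1%R, [:: 2; 3; 6; 7]); (-1%R, [:: 4; 5; 6; 7]);
      (-1%R, [:: 0; 2; 4; 6]); (1%R, [:: 0; 2; 5; 7]);
      (1%R, [:: 0; 3; 4; 7]); (1%R, [:: 0; 3; 5; 6]);
      (1%R, [:: 1; 2; 4; 7]); (1%R, [:: 1; 2; 5; 6]);
      (1%R, [:: 1; 3; 4; 6]); (-1%R, [:: 1; 3; 5; 7])]%N.

(* Evaluated here because the check below looks up this list thousands of times. *)
Definition spin7_monomials : seq (int * (nat * nat * nat * nat)) :=
  Eval vm_compute in
  [seq (p.1 * s.1, (nth 0 p.2 (nth 0 s.2 0), nth 0 p.2 (nth 0 s.2 1),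
                    nth 0 p.2 (nth 0 s.2 2), nth 0 p.2 (nth 0 s.2 3))%N)
     | p <- spin7_planes, s <- signed_perms4].

Lemma wedge4E (R : realType) (E : 'M[R]_8) a b c d i j k l :
  let e r := E (inord (nth 0%N [:: a.-1; b.-1; c.-1; d.-1] r)) in
  wedge4 E a b c d i j k l =
    \sum_(s <- signed_perms4) s.1%:~R *
      (e (nth 0%N s.2 0) i * e (nth 0%N s.2 1) j *
       e (nth 0%N s.2 2) k * e (nth 0%N s.2 3) l).
Proof.
move=> e.
transitivity (nat_det 4 (fun r s => e r (nth i [:: i; j; k; l] s))).
  congr (\det _); apply/matrixP => r s; rewrite !mxE (tnth_nth i) /e /=.
  by case: r => [[|[|[|[|r]]]] hr].
by rewrite nat_det4.
Qed.

Lemma spin7_formE (R : realType) (E : 'M[R]_8) i j k l :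
  spin7_form E i j k l =
    \sum_(m <- spin7_monomials) m.1%:~R *
      (E (inord m.2.1.1.1) i * E (inord m.2.1.1.2) j *
       E (inord m.2.1.2) k * E (inord m.2.2) l).
Proof.
pose W q := \sum_(s <- signed_perms4) s.1%:~R *
  (E (inord (nth 0%N q (nth 0%N s.2 0))) i *
   E (inord (nth 0%N q (nth 0%N s.2 1))) j *
   E (inord (nth 0%N q (nth 0%N s.2 2))) k *
   E (inord (nth 0%N q (nth 0%N s.2 3))) l).
have wW a b c d :
    wedge4 E a b c d i j k l = W [:: a.-1; b.-1; c.-1; d.-1].
  exact: wedge4E.
transitivity (\sum_(p <- spin7_planes) p.1%:~R * W p.2).
  (* [W] is generalized so that [ring] treats its values as atoms. *)
  rewrite /spin7_form !{}wW; move: W => W.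
  rewrite /spin7_planes !big_cons big_nil !mulrN1z !mulr1z !mulNr !mul1r /=.
  ring.
(* The evaluated list is folded back into its comprehension by conversion, so that the sum splits
   over planes and permutations. *)
rewrite -[spin7_monomials]/[seq (p.1 * s.1,
    (nth 0 p.2 (nth 0 s.2 0), nth 0 p.2 (nth 0 s.2 1),
     nth 0 p.2 (nth 0 s.2 2), nth 0 p.2 (nth 0 s.2 3))%N)
  | p <- spin7_planes, s <- signed_perms4].
rewrite big_allpairs_dep; apply: eq_bigr => p _.
by rewrite /W big_distrr; apply: eq_bigr => s _; rewrite /= intrM mulrA.
Qed.

(** * Integer coefficients of the model form and the identity for its square *)

Definition spin7_coef (i j k l : nat) : int :=
  foldr (fun m s => if m.2 == (i, j, k, l) then m.1 + s else s) 0
    spin7_monomials.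

Lemma spin7_form1E (R : realType) (i j k l : 'I_8) :
  spin7_form (1%:M : 'M[R]_8) i j k l = (spin7_coef i j k l)%:~R.
Proof.
rewrite spin7_formE /spin7_coef.
(* The bounds make [inord] exact on every label, so at the identity coframe each monomial is a
   product of Kronecker deltas. *)
have: all (fun m : int * (nat * nat * nat * nat) =>
    [&& m.2.1.1.1 < 8, m.2.1.1.2 < 8, m.2.1.2 < 8 & m.2.2 < 8]%N)
  spin7_monomials by vm_compute.
elim: spin7_monomials => [|[c [[[a b] d] e]] s IHs] /=.
  by rewrite big_nil.
move=> /andP[/and4P[a8 b8 d8 e8] /IHs{}IHs].
rewrite big_cons IHs !mxE /= -!val_eqE /= !inordK // !xpair_eqE.
case: eqP => _; rewrite ?(mul0r, mulr0, add0r) //.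
case: eqP => _; rewrite ?(mul0r, mulr0, add0r) //.
case: eqP => _; rewrite ?(mul0r, mulr0, add0r) //.
by case: eqP => _; rewrite ?(mulr1, mulr0, add0r, intrD).
Qed.

(* The pair [(i, j)] is encoded as [8 * i + j], as in [mxtens_index]. *)
Definition pair_coef (u v : nat) : int :=
  spin7_coef (u %/ 8) (u %% 8) (v %/ 8) (v %% 8).

Definition dot_product (r s : seq int) : int :=
  foldr (fun p a => p.1 * p.2 + a) 0 (zip r s).

Lemma dot_product_map (f g : nat -> int) s :
  dot_product (map f s) (map g s) = \sum_(w <- s) f w * g w.
Proof.
rewrite /dot_product.
by elim: s => [|w s IHs] /=; rewrite ?big_nil // big_cons IHs.
Qed.

Definition pair_coef_row u := (u, [seq pair_coef u w | w <- iota 0 64]).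
Definition pair_coef_col v := (v, [seq pair_coef w v | w <- iota 0 64]).

(** One entry of [phi^2 = 6 (1 - T) - 4 phi]; [c.1 %% 8 * 8 + c.1 %/ 8] encodes the pair [c.1] with
    its two indices swapped. *)
Definition square_check (r c : nat * seq int) : bool :=
  dot_product r.2 c.2 ==
  6 * ((r.1 == c.1)%:R - (r.1 == c.1 %% 8 * 8 + c.1 %/ 8)%N%:R)
    - 4 * nth 0 r.2 c.1.

(** Passing the lists as arguments lets the evaluator build the rows and columns once, instead of
    once for each of the 4096 entries. *)
Lemma square_check_all :
  (fun rows cols => all (fun r => all (square_check r) cols) rows)
  (map pair_coef_row (iota 0 64)) (map pair_coef_col (iota 0 64)).
Proof. by vm_compute. Qed.

Lemma pair_coef_square (u v : nat) : (u < 64)%N -> (v < 64)%N ->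
  \sum_(w < 64) pair_coef u w * pair_coef w v =
  6 * ((u == v)%:R - (u == v %% 8 * 8 + v %/ 8)%N%:R) - 4 * pair_coef u v.
Proof.
move=> u64 v64; have /allP/(_ (pair_coef_row u)) := square_check_all.
rewrite map_f ?mem_iota // => /(_ isT) /allP /(_ (pair_coef_col v)).
rewrite map_f ?mem_iota // => /(_ isT) /eqP.
rewrite /pair_coef_row /pair_coef_col; move: (mem_iota 0 64) (size_iota 0 64).
rewrite -(big_mkord xpredT (fun w => pair_coef u w * pair_coef w v)).
rewrite -[index_iota 0 64]/(iota 0 64) -dot_product_map.
(* The list becomes a variable carrying only the facts used about it, so that simplification cannot
   unfold it. *)
have := @nth_iota 0 0 64; move: (iota 0 64) => s nth_s mem_s size_s /= ->.
by rewrite (nth_map 0%N) ?size_s // nth_s.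
Qed.

(* Keeps simplification from unfolding the 336 monomials. *)
#[local] Opaque spin7_coef.

(** * Matrices indexed by pairs, and the swap of a pair *)

Definition pair_mx {R : Type} {n} (F : 'I_n -> 'I_n -> 'I_n -> 'I_n -> R) :
    'M[R]_(n * n) :=
  \matrix_(u, v) F (mxtens_unindex u).1 (mxtens_unindex u).2
                   (mxtens_unindex v).1 (mxtens_unindex v).2.

Lemma pair_mxE (R : Type) n (F : 'I_n -> 'I_n -> 'I_n -> 'I_n -> R) i j k l :
  pair_mx F (mxtens_index (i, j)) (mxtens_index (k, l)) = F i j k l.
Proof. by rewrite mxE !mxtens_indexK. Qed.

Lemma pair_mxP (R : Type) n (A B : 'M[R]_(n * n)) :
  (forall i j k l, A (mxtens_index (i, j)) (mxtens_index (k, l)) =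
                   B (mxtens_index (i, j)) (mxtens_index (k, l))) -> A = B.
Proof.
move=> AB; apply/matrixP => u v.
by case: (mxtens_indexP u) => i j; case: (mxtens_indexP v) => k l.
Qed.

Lemma sum_mxtens_index (V : nmodType) m n (f : 'I_(m * n) -> V) :
  \sum_u f u = \sum_i \sum_j f (mxtens_index (i, j)).
Proof.
rewrite pair_bigA (reindex (@mxtens_index m n)) /=; last first.
  exists (@mxtens_unindex m n) => u _.
    exact: mxtens_indexK.
  exact: mxtens_unindexK.
by apply: eq_bigr => -[].
Qed.

Definition swap_mx {K : pzSemiRingType} n : 'M[K]_(n * n) :=
  pair_mx (fun i j k l => ((i == l) && (j == k))%:R).

Section SwapMatrix.
Context {K : comPzRingType} {n : nat}.

(** Matches the arithmetic form of the swap in [square_check]. *)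
Lemma swap_mxE_nat (u v : 'I_(n * n)) :
  swap_mx n u v = (u == (v %% n * n + v %/ n)%N :> nat)%:R :> K.
Proof.
case: (mxtens_indexP u) => i j; case: (mxtens_indexP v) => k l.
rewrite pair_mxE; congr (nat_of_bool _)%:R.
have n_gt0 : (0 < n)%N by case: (n) (i) => // -[].
rewrite /= modnMDl divnMDl // divn_small // modn_small // addn0.
rewrite -[RHS]/(mxtens_index (i, j) == mxtens_index (l, k)).
by rewrite (can_eq (@mxtens_indexK n n)) xpair_eqE.
Qed.

Lemma swap_mul_mxE p (A : 'M[K]_(n * n, p)) i j v :
  (swap_mx n *m A) (mxtens_index (i, j)) v = A (mxtens_index (j, i)) v.
Proof.
rewrite mxE sum_mxtens_index (bigD1 j) //= (bigD1 i) //= pair_mxE !eqxx mul1r.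
rewrite !big1 ?addr0 // => [k kj|k ki].
  by rewrite big1 // => l _; rewrite pair_mxE andbC eq_sym (negPf kj) mul0r.
by rewrite pair_mxE eq_sym (negPf ki) mul0r.
Qed.

Lemma mul_swap_mxE p (A : 'M[K]_(p, n * n)) u k l :
  (A *m swap_mx n) u (mxtens_index (k, l)) = A u (mxtens_index (l, k)).
Proof.
rewrite mxE sum_mxtens_index (bigD1 l) //= (bigD1 k) //= pair_mxE !eqxx mulr1.
rewrite !big1 ?addr0 // => [i il|i ik].
  by rewrite big1 // => j _; rewrite pair_mxE (negPf il) mulr0.
by rewrite pair_mxE andbC (negPf ik) mulr0.
Qed.

Lemma swap_mxK : swap_mx n *m swap_mx n = 1%:M :> 'M[K]_(n * n).
Proof.
apply: pair_mxP => i j k l; rewrite swap_mul_mxE pair_mxE mxE.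
by rewrite (can_eq (@mxtens_indexK n n)) xpair_eqE andbC.
Qed.

Lemma swap_tensmx (A B : 'M[K]_n) :
  swap_mx n *m (A *t B) = (B *t A) *m swap_mx n.
Proof.
apply: pair_mxP => i j k l.
by rewrite swap_mul_mxE mul_swap_mxE !tensmxE mulrC.
Qed.

End SwapMatrix.

Lemma tensmx11 (K : pzRingType) n : (1%:M : 'M[K]_n) *t (1%:M : 'M[K]_n) = 1%:M.
Proof.
apply: pair_mxP => i j k l; rewrite tensmxE !mxE.
by rewrite (can_eq (@mxtens_indexK n n)) xpair_eqE -natrM mulnb.
Qed.

(** * Symmetries, change of coframe, and the square identity over the reals *)

Section Spin7Form.
Context {R : realType}.
Implicit Type E : 'M[R]_8.

Lemma wedge4_alternating E a b c d : alternating4 (wedge4 E a b c d).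
Proof.
by move=> i j k l; rewrite !wedge4E /signed_perms4 !big_cons !big_nil /=; split; ring.
Qed.

Lemma spin7_form_alternating E : alternating4 (spin7_form E).
Proof.
move=> i j k l; split; rewrite /spin7_form.
- by do !rewrite (fun a b c d => let: And3 h _ _ :=
    wedge4_alternating E a b c d i j k l in h); ring.
- by do !rewrite (fun a b c d => let: And3 _ h _ :=
    wedge4_alternating E a b c d i j k l in h); ring.
- by do !rewrite (fun a b c d => let: And3 _ _ h :=
    wedge4_alternating E a b c d i j k l in h); ring.
Qed.

(** A monomial is a product of four coframe entries, hence a rank-one matrix on pairs; changing the
    coframe is therefore congruence by [E *t E]. *)
Lemma pair_mx_spin7_form E :
  pair_mx (spin7_form E) =
    (E *t E)^T *m pair_mx (spin7_form 1%:M) *m (E *t E).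
Proof.
pose u (m : int * (nat * nat * nat * nat)) : 'I_(8 * 8) :=
  mxtens_index (inord m.2.1.1.1, inord m.2.1.1.2).
pose v (m : int * (nat * nat * nat * nat)) : 'I_(8 * 8) :=
  mxtens_index (inord m.2.1.2, inord m.2.2).
pose S : 'M[R]_(8 * 8) :=
  \sum_(m <- spin7_monomials) m.1%:~R *: delta_mx (u m) (v m).
(* Taking [E' = 1] identifies [S] as the matrix of the model form. *)
suff spin7_S (E' : 'M[R]_8) :
    pair_mx (spin7_form E') = (E' *t E')^T *m S *m (E' *t E').
  by rewrite !spin7_S tensmx11 trmx1 ?mul1mx ?mulmx1.
apply: pair_mxP => i j k l; rewrite pair_mxE spin7_formE.
rewrite mulmx_sumr mulmx_suml summxE; apply: eq_bigr => m _.
rewrite -scalemxAr -scalemxAl mxE; congr (_ * _).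
rewrite -(mul_delta_mx (0 : 'I_1)) mulmxA -colE -mulmxA -rowE.
by rewrite mxE big_ord1 !mxE !mxtens_indexK /= !mulrA.
Qed.

Lemma spin7_form_square :
  let P := pair_mx (spin7_form (1%:M : 'M[R]_8)) in
  P *m P = 6 *: (1%:M - swap_mx 8) - 4 *: P.
Proof.
move=> P; have PE u v : P u v = (pair_coef u v)%:~R.
  by rewrite mxE spin7_form1E.
apply/matrixP => u v; rewrite mxE.
under eq_bigr do rewrite !PE -intrM.
rewrite -rmorph_sum /= pair_coef_square //.
transitivity (6 * ((u == v)%:R - swap_mx 8 u v) - 4 * P u v : R); last first.
  by rewrite !mxE.
rewrite swap_mxE_nat PE.
by rewrite rmorphB !rmorphM rmorphB /= !mulrz_nat.
Qed.

End Spin7Form.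

(** * The dual form on bivectors *)

Lemma invmx_uniq (K : comUnitRingType) n (A B : 'M[K]_n) :
  A *m B = 1%:M -> A \in unitmx /\ invmx A = B.
Proof.
move=> AB; have [uA _] := mulmx1_unit AB; split=> //.
by rewrite -[invmx A]mulmx1 -AB mulmxA mulVmx // mul1mx.
Qed.

Section DualForm.
Context {R : realType}.
Local Notation T := (@swap_mx R 8).
Local Notation pair_form E := (pair_mx (spin7_form (R := R) E)).

(* [P] kills the symmetric pairs, so twice the projection onto them is added to
   make it invertible. *)
Definition sym_pair_mx : 'M[R]_(8 * 8) := 1%:M + T.

(** For a Spin(7) form this is twice the inverse of [P] on antisymmetric pairs and zero on symmetric
    ones: there [P + sym_pair_mx] acts as 2, and the subtracted term cancels the contribution of its
    inverse. *)
Definition dual_pair_mx (P : 'M[R]_(8 * 8)) : 'M[R]_(8 * 8) :=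
  2 *: invmx (P + sym_pair_mx) - 2^-1 *: sym_pair_mx.

Lemma swap_pair_form E : T *m pair_form E = - pair_form E.
Proof.
apply: pair_mxP => i j k l; rewrite swap_mul_mxE [RHS]mxE !pair_mxE.
by have [] := spin7_form_alternating E i j k l.
Qed.

Lemma pair_form_swap E : pair_form E *m T = - pair_form E.
Proof.
apply: pair_mxP => i j k l; rewrite mul_swap_mxE [RHS]mxE !pair_mxE.
by have [] := spin7_form_alternating E i j k l.
Qed.

Lemma dual_pair_formE E : E \in unitmx ->
  let P := pair_form E in let F := invmx E in let G := F *m F^T in
  let W := dual_pair_mx P in
  [/\ P + sym_pair_mx \in unitmx,
      W = 6^-1 *: pair_form F^T + 3^-1 *: (G *t G *m (1%:M - T)),
      P *m W = 1%:M - T, T *m W = - W & W *m T = - W].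
Proof.
move=> uE P F G W.
pose V := 6^-1 *: pair_form F^T + 3^-1 *: (G *t G *m (1%:M - T)).
pose phi := pair_form 1%:M.
have KL : (E *t E) *m (F *t F) = 1%:M.
  by rewrite tensmx_mul mulmxV // tensmx11.
have LK : (F *t F) *m (E *t E) = 1%:M.
  by rewrite tensmx_mul mulVmx // tensmx11.
have KLt : (E *t E)^T *m (F *t F)^T = 1%:M by rewrite -trmx_mul LK trmx1.
have TLt : T *m (F *t F)^T = (F *t F)^T *m T by rewrite trmx_tens swap_tensmx.
have TG : T *m (G *t G) = (G *t G) *m T by rewrite swap_tensmx.
have GE : G *t G = (F *t F) *m (F *t F)^T by rewrite trmx_tens tensmx_mul.
have PE : P = (E *t E)^T *m phi *m (E *t E) by exact: pair_mx_spin7_form.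
have FE : pair_form F^T = (F *t F) *m phi *m (F *t F)^T.
  by rewrite pair_mx_spin7_form trmx_tens trmxK trmx_tens.
have TT : T *m T = 1%:M by exact: swap_mxK.
have PV : P *m V = 1%:M - T.
  (* [X] is the form with its second pair of indices raised. It enters the two products below with
     coefficients -4 and 2, and the weights [6^-1] and [3^-1] in [V] make it cancel. *)
  pose X := (E *t E)^T *m phi *m (F *t F)^T.
  have PF : P *m pair_form F^T = 6 *: (1%:M - T) - 4 *: X.
    rewrite PE FE -!mulmxA (mulmxA (E *t E)) KL mul1mx (mulmxA phi).
    rewrite spin7_form_square mulmxBl mulmxBr -!scalemxAl -!scalemxAr.
    by rewrite mulmxBl mul1mx TLt mulmxBr mulmxA KLt mul1mx /X !mulmxA.
  have PG : P *m (G *t G *m (1%:M - T)) = 2 *: X.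
    rewrite PE GE -!mulmxA (mulmxA (E *t E)) KL mul1mx mulmxBr mulmx1 -TLt.
    rewrite mulmxBr (mulmxA phi T) pair_form_swap mulNmx opprK -mulr2n.
    by rewrite -scaler_nat -scalemxAr mulmxA.
  rewrite /V mulmxDr -!scalemxAr PF PG scalerBr !scalerA mulVf ?pnatr_eq0 //.
  rewrite scale1r -addrA -scaleNr -scalerDl.
  by rewrite (_ : - _ + _ = 0 :> R) ?scale0r ?addr0 //; field.
have TV : T *m V = - V.
  rewrite /V mulmxDr -!scalemxAr swap_pair_form mulmxA TG -mulmxA mulmxBr mulmx1.
  by rewrite TT -[T - _]opprB mulmxN !scalerN -opprD.
have VT : V *m T = - V.
  rewrite /V mulmxDl -!scalemxAl pair_form_swap -mulmxA mulmxBl mul1mx.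
  by rewrite TT -[T - _]opprB mulmxN !scalerN -opprD.
(* Antisymmetric and symmetric pairs are inverted separately, by [2^-1 *: V] and by
   [4^-1 *: sym_pair_mx]. *)
have VP : (P + sym_pair_mx) *m (2^-1 *: V + 4^-1 *: sym_pair_mx) = 1%:M.
  have PS : P *m sym_pair_mx = 0.
    by rewrite mulmxDr mulmx1 pair_form_swap subrr.
  have SV : sym_pair_mx *m V = 0 by rewrite mulmxDl mul1mx TV subrr.
  have SS : sym_pair_mx *m sym_pair_mx = 2 *: sym_pair_mx.
    have TS : T *m sym_pair_mx = sym_pair_mx by rewrite mulmxDr mulmx1 TT addrC.
    by rewrite {1}/sym_pair_mx mulmxDl mul1mx TS -mulr2n -scaler_nat.
  rewrite mulmxDl !mulmxDr -!scalemxAr PV PS SV SS !scaler0 addr0 add0r scalerA.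
  rewrite (_ : 4^-1 * 2 = 2^-1); last by field.
  by rewrite -scalerDr addrACA addNr addr0 -mulr2n -(scaler_nat 2 1%:M)
    scalerA mulVf ?scale1r.
have [uPS PSV] := invmx_uniq _ _ _ _ VP.
have WV : W = V.
  rewrite /W /dual_pair_mx PSV scalerDr !scalerA mulfV // scale1r.
  by rewrite (_ : 2 * 4^-1 = 2^-1) ?addrK //; field.
by rewrite WV.
Qed.

Lemma invmx_coframe_metric (E : 'M[R]_8) : E \in unitmx ->
  invmx (coframe_metric E) = invmx E *m (invmx E)^T.
Proof.
move=> uE; apply: (invmx_uniq _ _ _ _ _).2.
by rewrite -mulmxA (mulmxA E) mulmxV // mul1mx -trmx_mul mulVmx // trmx1.
Qed.

(** The alternating part of [W] is invariant under cyclic permutations of [i, j, k], so it cancels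
    with weights 2, -1, -1. The cyclic sum of the minors vanishes, so the same weights give three
    times the minor, which absorbs the factor [3^-1]. *)
Lemma dual_pair_form_cyclic E (i j k l : 'I_8) : E \in unitmx ->
  let W i j k l := dual_pair_mx (pair_form E)
    (mxtens_index (i, j)) (mxtens_index (k, l)) in
  let G := invmx (coframe_metric E) in
  G i k * G j l - G i l * G j k = 2 * W i j k l - W j k i l - W k i j l.
Proof.
move=> uE W G.
have GE : G = invmx E *m (invmx E)^T by exact: invmx_coframe_metric.
have [_ WE _ _ _] := dual_pair_formE E uE.
have GT : G^T = G by rewrite GE trmx_mul trmxK.
have Gt a b : G a b = G b a by rewrite -[in LHS]GT mxE.
pose f := spin7_form (invmx E)^T.
have GGT a b c d : (G *t G *m (1%:M - T))
    (mxtens_index (a, b)) (mxtens_index (c, d)) = G a c * G b d - G a d * G b c.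
  rewrite mulmxBr mulmx1 mxE tensmxE; congr (_ + _).
  by rewrite mxE mul_swap_mxE tensmxE.
have {}WE a b c d :
    W a b c d = 6^-1 * f a b c d + 3^-1 * (G a c * G b d - G a d * G b c).
  by rewrite /W WE -GE mxE [X in X + _]mxE pair_mxE [X in _ + X]mxE GGT.
have f12 a b c d : f b a c d = - f a b c d.
  by have [] := spin7_form_alternating (invmx E)^T a b c d.
have f23 a b c d : f a c b d = - f a b c d.
  by have [] := spin7_form_alternating (invmx E)^T a b c d.
rewrite !WE (f23 j i k l) (f12 i j k l) (f12 i k j l) (f23 i j k l).
rewrite (Gt k j) (Gt k i) (Gt j i); lra.
Qed.

End DualForm.

(** * Calculus of derivatives within [J] *)

Section DerivativeWithin.
Context {R : realType} (J : set R) (t : R).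
Hypothesis Jt : J t.
Implicit Types (f g : R -> R) (l m : R).

Lemma cvg_within_eq f g l : (forall s, J s -> f s = g s) ->
  f s @[s --> within J t^'] --> l -> g s @[s --> within J t^'] --> l.
Proof.
move=> fg; apply: cvg_trans; apply: near_eq_cvg.
have FJ : within J t^' J by exact: withinT.
by apply: filterS FJ => s Js; exact: fg.
Qed.

Lemma has_deriv_within_eq f g l : (forall s, J s -> f s = g s) ->
  has_deriv_within J f t l -> has_deriv_within J g t l.
Proof. by move=> fg h; apply: (cvg_within_eq _ _ _ _ h) => s Js; rewrite !fg. Qed.

Lemma has_deriv_within_cst c : has_deriv_within J (fun=> c) t 0.
Proof.
by apply: (cvg_within_eq (fun=> 0)) => [s _|]; [rewrite subrr mulr0|exact: cvg_cst].
Qed.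

Lemma has_deriv_withinD f g l m : has_deriv_within J f t l ->
  has_deriv_within J g t m -> has_deriv_within J (fun s => f s + g s) t (l + m).
Proof.
move=> fl gm; apply: (cvg_within_eq _ _ _ _ (cvgD fl gm)) => s _ /=.
by rewrite -mulrDr opprD addrACA.
Qed.

Lemma has_deriv_withinZ c f l : has_deriv_within J f t l ->
  has_deriv_within J (fun s => c * f s) t (c * l).
Proof.
move=> fl; apply: (cvg_within_eq _ _ _ _ (cvgMl_tmp (a := c) fl)) => s _ /=.
by rewrite -mulrBr mulrCA.
Qed.

Lemma has_deriv_withinN f l : has_deriv_within J f t l ->
  has_deriv_within J (fun s => - f s) t (- l).
Proof.
move=> /(has_deriv_withinZ (-1)); rewrite mulN1r.
by apply: has_deriv_within_eq => s _; rewrite mulN1r.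
Qed.

Lemma has_deriv_within_cvg f l : has_deriv_within J f t l ->
  f s @[s --> within J t^'] --> f t.
Proof.
move=> fl.
have st : (s - t) @[s --> within J t^'] --> (0 : R).
  rewrite -(subrr t); apply: cvgB; last exact: cvg_cst.
  apply: cvg_trans (cvg_within J) _; exact: nbhs_dnbhs.
have h : (f t + (s - t) * ((s - t)^-1 * (f s - f t))) @[s --> within J t^']
    --> f t + 0 * l by apply: cvgD; [exact: cvg_cst|exact: cvgM].
rewrite mul0r addr0 in h; apply: (cvg_within_eq _ _ _ _ h) => s _ /=.
(* The equality is asked on all of [J], including [s = t], where both sides reduce to [f t]. *)
have [->|/negPf st0] := eqVneq s t; first by rewrite subrr mul0r addr0.
by rewrite mulrA mulfV ?subr_eq0 ?st0 // mul1r addrC subrK.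
Qed.

Lemma has_deriv_withinM f g l m : has_deriv_within J f t l ->
  has_deriv_within J g t m ->
  has_deriv_within J (fun s => f s * g s) t (l * g t + f t * m).
Proof.
move=> fl gm; have gt := has_deriv_within_cvg _ _ gm.
apply: (cvg_within_eq _ _ _ _ (cvgD (cvgM fl gt) (cvgMl_tmp (a := f t) gm))) => s _ /=.
ring.
Qed.

Lemma has_deriv_withinV f l : (forall s, J s -> f s != 0) ->
  has_deriv_within J f t l ->
  has_deriv_within J (fun s => (f s)^-1) t (- l / f t ^+ 2).
Proof.
move=> f0 fl; have ft : (f s)^-1 @[s --> within J t^'] --> (f t)^-1.
  by apply: cvgV; [exact: f0|exact: (has_deriv_within_cvg _ _ fl)].
have h : (- ((s - t)^-1 * (f s - f t) * (f s)^-1) * (f t)^-1)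
    @[s --> within J t^'] --> - (l * (f t)^-1) * (f t)^-1.
  by apply: cvgMr_tmp; apply: cvgN; exact: (cvgM fl ft).
rewrite -mulNr -mulrA -invfM -expr2 in h.
apply: (cvg_within_eq _ _ _ _ h) => s Js /=.
transitivity ((s - t)^-1 * (- (f s - f t) / f s / f t)); first by ring.
by congr (_ * _); field; rewrite !f0.
Qed.

(** The difference quotient of the root is that of [f] divided by the sum of the two roots. *)
Lemma has_deriv_within_sqrt f l : (forall s, J s -> 0 < f s) ->
  has_deriv_within J f t l ->
  has_deriv_within J (fun s => Num.sqrt (f s)) t (l / (2 * Num.sqrt (f t))).
Proof.
move=> f0 fl.
have ft : Num.sqrt (f s) @[s --> within J t^'] --> Num.sqrt (f t).
  apply: continuous_cvg; first exact: sqrt_continuous.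
  exact: (has_deriv_within_cvg _ _ fl).
have pos s : J s -> 0 < Num.sqrt (f s) by move=> Js; rewrite sqrtr_gt0 f0.
have pos2 s : J s -> Num.sqrt (f s) + Num.sqrt (f t) != 0.
  by move=> Js; rewrite gt_eqF // addr_gt0 ?pos.
have h : ((s - t)^-1 * (f s - f t) / (Num.sqrt (f s) + Num.sqrt (f t)))
    @[s --> within J t^'] --> l / (Num.sqrt (f t) + Num.sqrt (f t)).
  apply: cvgM => //; apply: cvgV; first exact: pos2.
  by apply: cvgD; last exact: cvg_cst.
rewrite -mulr2n -mulr_natl in h.
apply: (cvg_within_eq _ _ _ _ h) => s Js /=; rewrite -!mulrA.
rewrite -[X in (X - _) / _](sqr_sqrtr (ltW (f0 s Js))).
rewrite -[X in (_ - X) / _](sqr_sqrtr (ltW (f0 t Jt))).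
by congr (_ * _); field; rewrite pos2.
Qed.

Lemma has_deriv_within_unique f l m : ProperFilter (within J t^') ->
  has_deriv_within J f t l -> has_deriv_within J f t m -> l = m.
Proof. by move=> PF fl fm; apply: (cvg_unique _ fl fm). Qed.

(** Covers an interval reduced to a point, where the filter contains the empty set and every limit
    holds. *)
Lemma has_deriv_within_isolated f l : within J t^' set0 -> has_deriv_within J f t l.
Proof. by move=> J0 A _; apply: filterS J0. Qed.

Lemma proper_within : ~ within J t^' set0 -> ProperFilter (within J t^').
Proof. by move=> J0; split=> //; exact: within_filter. Qed.

End DerivativeWithin.

(** * Limits and derivatives of matrix inverses *)

Section MatrixLimits.
Context {R : realType} {T : Type} (F : set_system T) {FF : Filter F}.

Lemma cvg_det n (A : T -> 'M[R]_n) (B : 'M[R]_n) :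
  (forall i j, A s i j @[s --> F] --> B i j) -> \det (A s) @[s --> F] --> \det B.
Proof.
move=> AB; apply: cvg_big => [|p _]; first exact: add_continuous.
apply: cvgMl_tmp; apply: cvg_big => [|i _]; first exact: mul_continuous.
exact: AB.
Qed.

Lemma cvg_mulmx m n p (A : T -> 'M[R]_(m, n)) (B : T -> 'M[R]_(n, p))
    (A0 : 'M[R]_(m, n)) (B0 : 'M[R]_(n, p)) :
  (forall i j, A s i j @[s --> F] --> A0 i j) ->
  (forall i j, B s i j @[s --> F] --> B0 i j) ->
  forall i j, (A s *m B s) i j @[s --> F] --> (A0 *m B0) i j.
Proof.
move=> AA0 BB0 i j; rewrite mxE; under eq_cvg do rewrite mxE.
apply: cvg_big => [|k _]; first exact: add_continuous.
exact: (cvgM (AA0 i k) (BB0 k j)).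
Qed.

(** The inverse is the adjugate over the determinant, both polynomial in the entries. Invertibility
    fixes the branch of [invmx], which returns a singular matrix unchanged. *)
Lemma cvg_invmx n (A : T -> 'M[R]_n) (B : 'M[R]_n) :
  B \in unitmx -> (forall s, A s \in unitmx) ->
  (forall i j, A s i j @[s --> F] --> B i j) ->
  forall i j, invmx (A s) i j @[s --> F] --> invmx B i j.
Proof.
move=> uB uA AB i j; rewrite /invmx uB !mxE.
under eq_cvg do rewrite uA !mxE.
apply: cvgM; first by apply: cvgV; [rewrite -unitfE -unitmxE|exact: cvg_det].
apply: cvgMl_tmp; apply: cvg_det => k l; rewrite !mxE.
by under eq_cvg do rewrite !mxE; exact: AB.
Qed.

End MatrixLimits.

Definition mx_deriv_within {R : realType} (J : set R) {m n}
    (A : R -> 'M[R]_(m, n)) (t : R) (D : 'M[R]_(m, n)) : Prop :=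
  forall i j, has_deriv_within J (fun s => A s i j) t (D i j).

(** Divide [A(s)^-1 - A(t)^-1 = - A(s)^-1 (A(s) - A(t)) A(t)^-1] by [s - t] and pass to the
    limit. *)
Lemma mx_deriv_within_invmx (R : realType) (J : set R) n (A : R -> 'M[R]_n) t D :
  J t -> (forall s, J s -> A s \in unitmx) -> mx_deriv_within J A t D ->
  mx_deriv_within J (fun s => invmx (A s)) t (- (invmx (A t) *m D *m invmx (A t))).
Proof.
move=> Jt uA AD.
(* Outside [J] the family takes the value [A t], since [cvg_invmx] wants an invertible matrix at
   every [s]. *)
pose A' s := if s \in J then A s else A t.
have A'E s : J s -> A' s = A s by move=> /mem_set Js; rewrite /A' Js.
have uA' s : A' s \in unitmx by rewrite /A'; case: ifP => [/set_mem|_]; exact: uA.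
pose Q s : 'M[R]_n := \matrix_(i, j) ((s - t)^-1 * (A s i j - A t i j)).
have invA' i j : invmx (A' s) i j @[s --> within J t^'] --> invmx (A t) i j.
  apply: cvg_invmx => // [|k l]; first exact: uA.
  have h := has_deriv_within_cvg _ _ _ _ (AD k l).
  by apply: (cvg_within_eq _ _ _ _ _ _ h) => s Js; rewrite A'E.
have cst i j : invmx (A t) i j @[s --> within J t^'] --> invmx (A t) i j.
  exact: cvg_cst.
have QD i j : Q s i j @[s --> within J t^'] --> D i j.
  by under eq_cvg do rewrite mxE; exact: AD.
move=> i j; rewrite /has_deriv_within mxE.
have h : - (invmx (A' s) *m Q s *m invmx (A t)) i j @[s --> within J t^'] -->
    - (invmx (A t) *m D *m invmx (A t)) i j.
  by apply: cvgN; do 2?apply: cvg_mulmx.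
apply: (cvg_within_eq _ _ _ _ _ _ h) => s Js; rewrite A'E //.
have -> : Q s = (s - t)^-1 *: (A s - A t) by apply/matrixP => k l; rewrite !mxE.
rewrite -scalemxAr -scalemxAl mulmxBr mulVmx ?uA // mulmxBl mul1mx -mulmxA.
by rewrite mulmxV ?uA // mulmx1 !mxE -mulrN opprB.
Qed.

(** * Positivity of Gram matrices *)

Section PositiveMinors.
Context {R : realType} {n : nat} (F : 'M[R]_n).
Hypothesis uF : F \in unitmx.
Let G := F *m F^T.

Lemma gram_sym i j : G i j = G j i.
Proof.
have GT : G^T = G by rewrite trmx_mul trmxK.
by rewrite -[in LHS]GT mxE.
Qed.

Lemma gram_quadratic_gt0 (v : 'rV[R]_n) : v != 0 -> 0 < (v *m G *m v^T) 0 0.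
Proof.
move=> v0.
have -> : v *m G *m v^T = (v *m F) *m (v *m F)^T by rewrite trmx_mul !mulmxA.
have sq i : 0 <= (v *m F) 0 i * (v *m F) 0 i by rewrite -expr2 sqr_ge0.
rewrite mxE; under eq_bigr do rewrite [_^T _ _]mxE.
rewrite lt_def sumr_ge0 ?andbT //; apply: contra_neqN v0 => /eqP s0.
suff vF0 : v *m F = 0 by rewrite -[v](mulmxK uF) vF0 mul0mx.
apply/rowP => i; rewrite [RHS]mxE; apply/eqP; rewrite -sqrf_eq0 expr2.
move/eqP: s0; rewrite psumr_eq0 // => /allP/(_ i).
by rewrite mem_index_enum => /(_ isT).
Qed.

Lemma gram_quadratic3_gt0 (i j k : 'I_n) (a b c : R) :
  i != j -> i != k -> j != k -> [|| a != 0, b != 0 | c != 0] ->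
  0 < a ^+ 2 * G i i + b ^+ 2 * G j j + c ^+ 2 * G k k
      + 2 * (a * b * G i j + a * c * G i k + b * c * G j k).
Proof.
move=> ij ik jk abc.
pose v : 'rV[R]_n := a *: delta_mx 0 i + b *: delta_mx 0 j + c *: delta_mx 0 k.
have v0 : v != 0.
  apply: contraTneq abc => v0.
  have vE l : a * (l == i)%:R + b * (l == j)%:R + c * (l == k)%:R = 0.
    by move/rowP: v0 => /(_ l); rewrite !mxE.
  have := vE i; have := vE j; have := vE k.
  rewrite !eqxx (negPf ij) (negPf ik) (negPf jk) ![k == _]eq_sym ![j == i]eq_sym.
  rewrite (negPf ij) (negPf ik) (negPf jk) !mulr1 !mulr0 !addr0 !add0r => -> -> ->.
  by rewrite eqxx.
have -> : a ^+ 2 * G i i + b ^+ 2 * G j j + c ^+ 2 * G k k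
      + 2 * (a * b * G i j + a * c * G i k + b * c * G j k) =
    (v *m G *m v^T) 0 0; last exact: gram_quadratic_gt0.
have de p q : (delta_mx 0 p *m G *m (delta_mx 0 q)^T) (0 : 'I_1) (0 : 'I_1) = G p q.
  by rewrite -rowE trmx_delta -colE !mxE.
have vT : v^T = a *: (delta_mx 0 i)^T + b *: (delta_mx 0 j)^T
                + c *: (delta_mx 0 k)^T by rewrite /v !linearD /= !linearZ.
rewrite vT /v !mulmxDl !mulmxDr -!scalemxAl -!scalemxAr.
have DE (A B : 'M[R]_1) : (A + B) 0 0 = A 0 0 + B 0 0 by rewrite mxE.
have ZE x (A : 'M[R]_1) : (x *: A) 0 0 = x * A 0 0 by rewrite mxE.
rewrite !(DE, ZE) !de (gram_sym j i) (gram_sym k i) (gram_sym k j).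
ring.
Qed.

End PositiveMinors.

(** * Recovering a Gram matrix from its 2 x 2 minors *)

Definition minor2 {R : pzRingType} {n} (G : 'M[R]_n) (i j k l : 'I_n) : R :=
  G i k * G j l - G i l * G j k.

(** The determinant of the principal submatrix on [i, j, k], expanded for symmetric [G]. *)
Definition principal_minor3 {R : pzRingType} {n} (G : 'M[R]_n) (i j k : 'I_n) : R :=
  G i i * G j j * G k k + 2 * (G i j * G i k * G j k)
  - G i i * G j k ^+ 2 - G j j * G i k ^+ 2 - G k k * G i j ^+ 2.

(* The determinant of the second compound of a 3 x 3 matrix [A] is [\det A ^+ 2]. *)
Definition compound_minor {R : pzRingType} {n} (G : 'M[R]_n) (i j k : 'I_n) : R :=
  minor2 G i j i j * minor2 G i k i k * minor2 G j k j k
  + 2 * (minor2 G i j i k * minor2 G i j j k * minor2 G i k j k)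
  - minor2 G i j i j * minor2 G i k j k ^+ 2
  - minor2 G i k i k * minor2 G i j j k ^+ 2
  - minor2 G j k j k * minor2 G i j i k ^+ 2.

Section SymmetricMinors.
Context {R : comPzRingType} {n : nat} (G : 'M[R]_n).
Hypothesis G_sym : forall i j, G i j = G j i.

Lemma compound_minorE i j k : compound_minor G i j k = principal_minor3 G i j k ^+ 2.
Proof.
rewrite /compound_minor /principal_minor3 /minor2 (G_sym j i) (G_sym k i) (G_sym k j).
ring.
Qed.

(** An instance of Jacobi's identity, like the next lemma: up to sign, a 2 x 2 minor of the second
    compound of a 3 x 3 matrix is an entry of that matrix times its determinant. *)
Lemma diag_principal_minor3 i j k :
  G i i * principal_minor3 G i j k =
    minor2 G i j i j * minor2 G i k i k - minor2 G i j i k ^+ 2.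
Proof.
rewrite /principal_minor3 /minor2 ?(G_sym j i) ?(G_sym k i) ?(G_sym k j); ring.
Qed.

Lemma offdiag_principal_minor3 i j k :
  G i j * principal_minor3 G i j k =
    minor2 G i j i j * minor2 G i k j k - minor2 G i j i k * minor2 G i j j k.
Proof.
rewrite /principal_minor3 /minor2 ?(G_sym j i) ?(G_sym k i) ?(G_sym k j); ring.
Qed.

End SymmetricMinors.

(** Let [p], [m], [d] be the leading minors of the submatrix. The quadratic form takes the values
    [p], [p m] and [m d] at [(1, 0, 0)], at [(- G i j, G i i, 0)] and at the cofactors of the third
    row. *)
Lemma principal_minor3_gt0 (R : realType) n (F : 'M[R]_n) (i j k : 'I_n) :
  F \in unitmx -> i != j -> i != k -> j != k ->
  0 < principal_minor3 (F *m F^T) i j k.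
Proof.
move=> uF ij ik jk.
have q := gram_quadratic3_gt0 F uF i j k _ _ _ ij ik jk.
have S := gram_sym F.
move: (F *m F^T) q S => G q S.
have p_gt0 : 0 < G i i.
  by have := q 1 0 0; rewrite oner_eq0 => /(_ isT); congr (0 < _); ring.
have m_gt0 : 0 < G i i * G j j - G i j ^+ 2.
  have := q (- G i j) (G i i) 0; rewrite (gt_eqF p_gt0) orbT => /(_ isT).
  rewrite -[X in _ -> is_true X](pmulr_rgt0 _ p_gt0); congr (0 < _); ring.
have := q (G i j * G j k - G i k * G j j) (G i j * G i k - G i i * G j k)
  (G i i * G j j - G i j ^+ 2).
rewrite (gt_eqF m_gt0) !orbT => /(_ isT).
rewrite -[X in _ -> is_true X](pmulr_rgt0 _ m_gt0); congr (0 < _).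
rewrite /principal_minor3; ring.
Qed.

Lemma exists_third_ord n (i j : 'I_n) : (2 < n)%N -> exists k, k != i /\ k != j.
Proof.
move=> n2; have /card_gt0P[k] : (0 < #|[predC [:: i; j]]|)%N.
  rewrite -(ltn_add2l #|[:: i; j]|) addn0 (cardC (mem [:: i; j])) card_ord.
  by apply: leq_ltn_trans n2; exact: (card_size [:: i; j]).
by rewrite !inE negb_or => /andP[]; exists k.
Qed.

(** Gives only the existence of the derivative; its value is found later by comparing derivatives of
    the minors. *)
Lemma gram_derivable_of_minors (R : realType) (J : set R) (t : R) n
    (G : R -> 'M[R]_n) : (2 < n)%N -> J t ->
  (forall s, J s -> exists2 F, F \in unitmx & G s = F *m F^T) ->
  (forall i j k l, exists D, has_deriv_within J (fun s => minor2 (G s) i j k l) t D) ->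
  forall i j, exists D, has_deriv_within J (fun s => G s i j) t D.
Proof.
move=> n2 Jt GF dN.
pose dble (f : R -> R) := exists l, has_deriv_within J f t l.
have dM f g : dble f -> dble g -> dble (fun s => f s * g s).
  by move=> [l fl] [m gm]; eexists; exact: (has_deriv_withinM _ _ _ _ _ _ fl gm).
have dD f g : dble f -> dble g -> dble (fun s => f s + g s).
  by move=> [l fl] [m gm]; eexists; exact: (has_deriv_withinD _ _ _ _ _ _ fl gm).
have dO f : dble f -> dble (fun s => - f s).
  by move=> [l fl]; eexists; exact: (has_deriv_withinN _ _ Jt _ _ fl).
have dZ c f : dble f -> dble (fun s => c * f s).
  by move=> [l fl]; eexists; exact: (has_deriv_withinZ _ _ c _ _ fl).
have G_sym s : J s -> forall i j, G s i j = G s j i.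
  by move=> /GF[F _ ->] i j; exact: gram_sym.
have d_gt0 i j k s : J s -> i != j -> i != k -> j != k ->
    0 < principal_minor3 (G s) i j k.
  by move=> /GF[F uF ->]; exact: principal_minor3_gt0.
(* The determinant is the positive root of [compound_minor], a polynomial in the 2 x 2 minors. *)
have dP i j k : i != j -> i != k -> j != k ->
    dble (fun s => (principal_minor3 (G s) i j k)^-1).
  move=> ij ik jk.
  have [l cl] : dble (fun s => compound_minor (G s) i j k).
    have dX f : dble f -> dble (fun s => f s ^+ 2) by move=> df; exact: dM.
    by do ?[exact: (dN)|apply: (dO)|apply: (dD)|apply: (dX)|apply: (dZ)|apply: (dM)].
  have c_gt0 s : J s -> 0 < compound_minor (G s) i j k.
    move=> Js; rewrite (compound_minorE _ (G_sym _ Js)); apply: exprn_gt0.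
    exact: d_gt0.
  have sl := has_deriv_within_sqrt _ _ Jt _ _ c_gt0 cl.
  have s0 s : J s -> Num.sqrt (compound_minor (G s) i j k) != 0.
    by move=> Js; rewrite gt_eqF // sqrtr_gt0 c_gt0.
  have iv := has_deriv_withinV _ _ Jt _ _ s0 sl.
  eexists; apply: has_deriv_within_eq iv => // s Js.
  by rewrite (compound_minorE _ (G_sym _ Js)) sqrtr_sqr gtr0_norm // d_gt0.
move=> i j; have [<-|ij] := eqVneq i j.
  (* A diagonal entry needs two further indices to form a triple, an off-diagonal entry only one. *)
  have [j' [j'i _]] := exists_third_ord _ i i n2.
  have [k [ki kj']] := exists_third_ord _ i j' n2.
  rewrite eq_sym in j'i; rewrite eq_sym in ki; rewrite eq_sym in kj'.
  suff [l fl] : dble (fun s => (minor2 (G s) i j' i j' * minor2 (G s) i k i k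
      - minor2 (G s) i j' i k ^+ 2) * (principal_minor3 (G s) i j' k)^-1).
    exists l; apply: has_deriv_within_eq fl => // s Js.
    rewrite -diag_principal_minor3; last exact: G_sym.
    by rewrite mulfK // gt_eqF // d_gt0.
  apply: (dM _ _ _ (dP _ _ _ j'i ki kj')); apply: (dD); first exact: (dM).
  by apply: (dO); exact: (dM).
have [k [ki kj]] := exists_third_ord _ i j n2.
rewrite eq_sym in ki; rewrite eq_sym in kj.
suff [l fl] : dble (fun s => (minor2 (G s) i j i j * minor2 (G s) i k j k
    - minor2 (G s) i j i k * minor2 (G s) i j j k)
    * (principal_minor3 (G s) i j k)^-1).
  exists l; apply: has_deriv_within_eq fl => // s Js.
  rewrite -offdiag_principal_minor3; last exact: G_sym.
  by rewrite mulfK // gt_eqF // d_gt0.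
apply: (dM _ _ _ (dP _ _ _ ij ki kj)); apply: (dD); first exact: (dM).
by apply: (dO); exact: (dM).
Qed.

(** * A matrix acting as a derivation on pairs of indices *)

Definition pair_derivation {K : pzRingType} {n} (C : 'M[K]_n) : 'M[K]_(n * n) :=
  C *t 1%:M + 1%:M *t C.

Section PairDerivation.
Context {K : comPzRingType} {n : nat} (C : 'M[K]_n).

Lemma pair_derivation_mulE (A : 'M[K]_(n * n)) i j k l :
  (pair_derivation C *m A) (mxtens_index (i, j)) (mxtens_index (k, l)) =
  \sum_m (C i m * A (mxtens_index (m, j)) (mxtens_index (k, l))
        + C j m * A (mxtens_index (i, m)) (mxtens_index (k, l))).
Proof.
rewrite big_split /= mulmxDl mxE; congr (_ + _).
  rewrite mxE sum_mxtens_index; apply: eq_bigr => m _.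
  rewrite (bigD1 j) //= tensmxE mxE eqxx mulr1 big1 ?addr0 // => p pj.
  by rewrite tensmxE mxE eq_sym (negPf pj) mulr0 mul0r.
rewrite mxE sum_mxtens_index exchange_big /=; apply: eq_bigr => m _.
rewrite (bigD1 i) //= tensmxE mxE eqxx mul1r big1 ?addr0 // => p pi.
by rewrite tensmxE mxE eq_sym (negPf pi) !mul0r.
Qed.

Lemma mul_pair_derivationE (A : 'M[K]_(n * n)) i j k l :
  (A *m pair_derivation C) (mxtens_index (i, j)) (mxtens_index (k, l)) =
  \sum_m (A (mxtens_index (i, j)) (mxtens_index (m, l)) * C m k
        + A (mxtens_index (i, j)) (mxtens_index (k, m)) * C m l).
Proof.
rewrite big_split /= mulmxDr mxE; congr (_ + _).
  rewrite mxE sum_mxtens_index; apply: eq_bigr => m _.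
  rewrite (bigD1 l) //= tensmxE mxE eqxx mulr1 big1 ?addr0 // => p pl.
  by rewrite tensmxE mxE (negPf pl) !mulr0.
rewrite mxE sum_mxtens_index exchange_big /=; apply: eq_bigr => m _.
rewrite (bigD1 k) //= tensmxE mxE eqxx mul1r big1 ?addr0 // => p pk.
by rewrite tensmxE mxE (negPf pk) mul0r mulr0.
Qed.

Lemma trmx_pair_derivation : (pair_derivation C)^T = pair_derivation C^T.
Proof. by rewrite linearD /= !trmx_tens trmx1. Qed.

Lemma swap_pair_derivation :
  swap_mx n *m pair_derivation C = pair_derivation C *m swap_mx n.
Proof. by rewrite mulmxDr mulmxDl !swap_tensmx addrC. Qed.

End PairDerivation.

(** * Derivatives of the dual form and of the minors *)

Section MetricDerivative.
Context {R : realType} (J : set R) (t : R).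
Hypothesis Jt : J t.

(** With [B = P + sym_pair_mx] and [c] the derivation, [W' = - 2 B^-1 (c P + P c^T) B^-1]. Put
    [U = 1 - T]: it commutes with [c] and [c^T], [P B^-1 = B^-1 P = U / 2] and
    [U B^-1 = B^-1 U = W], so the two terms become [W c] and [c^T W]. *)
Lemma dual_pair_form_deriv (E : R -> 'M[R]_8) (C : 'M[R]_8) :
  let P s := pair_mx (spin7_form (E s)) in
  let W s := dual_pair_mx (P s) in
  (forall s, J s -> E s \in unitmx) ->
  mx_deriv_within J P t
    (pair_derivation C *m P t + P t *m (pair_derivation C)^T) ->
  mx_deriv_within J W t
    (- (W t *m pair_derivation C + pair_derivation C^T *m W t)).
Proof.
move=> P W uE PD.
pose B s := P s + sym_pair_mx.
have BD : mx_deriv_within J B t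
    (pair_derivation C *m P t + P t *m (pair_derivation C)^T).
  move=> i j.
  have h := has_deriv_withinD _ _ _ _ _ _ (PD i j)
    (has_deriv_within_cst J t (sym_pair_mx i j)).
  rewrite addr0 in h; apply: (has_deriv_within_eq _ _ Jt _ _ _ _ h) => s _.
  by rewrite [RHS]mxE.
have uB s : J s -> B s \in unitmx.
  by move=> /uE us; have [] := dual_pair_formE _ us.
have invD := mx_deriv_within_invmx _ _ _ _ _ _ Jt uB BD.
have [_ _ PW TW WT] := dual_pair_formE _ (uE t Jt).
rewrite -/(P t) -/(W t) in PW TW WT.
pose S : 'M[R]_(8 * 8) := sym_pair_mx; pose c := pair_derivation C.
have invB : invmx (B t) = 2^-1 *: W t + 4^-1 *: S.
  rewrite /W /dual_pair_mx scalerBr !scalerA mulVf ?scale1r //.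
  by rewrite (_ : 2^-1 * 2^-1 = 4^-1) ?subrK //; field.
have TT : swap_mx 8 *m swap_mx 8 = 1%:M :> 'M[R]_(8 * 8) by exact: swap_mxK.
pose U : 'M[R]_(8 * 8) := 1%:M - swap_mx 8.
have US : U *m S = 0.
  rewrite mulmxBl mul1mx mulmxDr mulmx1 TT.
  by rewrite [X in _ - X]addrC subrr.
have SU : S *m U = 0.
  rewrite mulmxBr mulmx1 mulmxDl mul1mx TT.
  by rewrite [X in _ - X]addrC subrr.
have UW : U *m invmx (B t) = W t.
  rewrite invB mulmxDr -!scalemxAr US scaler0 addr0 mulmxBl mul1mx TW opprK.
  by rewrite -mulr2n -(scaler_nat 2 (W t)) scalerA mulVf ?scale1r.
have WU : invmx (B t) *m U = W t.
  rewrite invB mulmxDl -!scalemxAl SU scaler0 addr0 mulmxBr mulmx1 WT opprK.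
  by rewrite -mulr2n -(scaler_nat 2 (W t)) scalerA mulVf ?scale1r.
have BU : P t *m invmx (B t) = 2^-1 *: U.
  have PS : P t *m S = 0 by rewrite mulmxDr mulmx1 pair_form_swap subrr.
  by rewrite invB mulmxDr -!scalemxAr PS scaler0 addr0 PW.
(* Since [P = B - S], the product is [1 - S / 2], which equals [U / 2]. *)
have UB : invmx (B t) *m P t = 2^-1 *: U.
  have SB : invmx (B t) *m S = 2^-1 *: S.
    have SS : S *m S = 2 *: S.
      rewrite {1}/S mulmxDl mul1mx mulmxDr mulmx1 TT [X in _ + X]addrC.
      by rewrite -mulr2n -(scaler_nat 2 S).
    have WS : W t *m S = 0 by rewrite mulmxDr mulmx1 WT subrr.
    rewrite invB mulmxDl -!scalemxAl WS SS scaler0 add0r scalerA.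
    by congr (_ *: _); field.
  rewrite -[P t](addrK S) mulmxBr mulVmx ?uB // SB /S /sym_pair_mx.
  rewrite scalerDr scalerBr opprD addrA; congr (_ - _).
  rewrite -{1}[1%:M]scale1r -scalerBl; congr (_ *: _); lra.
have Uc D : U *m pair_derivation D = pair_derivation D *m U.
  by rewrite mulmxBl mulmxBr mul1mx mulmx1 swap_pair_derivation.
have invBPinvB : 2 *: (invmx (B t) *m (c *m P t + P t *m c^T) *m invmx (B t)) =
    W t *m c + c^T *m W t.
  rewrite mulmxDr mulmxDl -!mulmxA BU (mulmxA _ (P t)) UB.
  rewrite -!scalemxAr -!scalemxAl -scalerDr scalerA mulfV ?pnatr_eq0 // scale1r.
  by rewrite /c trmx_pair_derivation -Uc !mulmxA WU Uc -[_ *m U *m _]mulmxA UW.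
move=> i j.
have h := has_deriv_withinD _ _ _ _ _ _ (has_deriv_withinZ _ _ 2 _ _ (invD i j))
  (has_deriv_within_cst J t (- (2^-1 * S i j))).
have ZE x (A : 'M[R]_(8 * 8)) u v : (x *: A) u v = x * A u v by rewrite mxE.
have NE (A : 'M[R]_(8 * 8)) u v : (- A) u v = - A u v by rewrite mxE.
rewrite addr0 -ZE scalerN invBPinvB /c trmx_pair_derivation in h.
apply: (has_deriv_within_eq _ _ Jt _ _ _ _ h) => s _.
by rewrite /W /dual_pair_mx [RHS]mxE NE !ZE.
Qed.

(** The derivation treats the four indices alike, so it commutes with the cyclic combination that
    expresses the minors through [W]. Sorting the terms by the factors of each minor gives the
    product rule with [Y] in place of the derivative of [G]. *)
Lemma minor2_deriv (E : R -> 'M[R]_8) (C : 'M[R]_8) :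
  let G s := invmx (coframe_metric (E s)) in
  let P s := pair_mx (spin7_form (E s)) in
  let Y := - (C^T *m G t + G t *m C) in
  (forall s, J s -> E s \in unitmx) ->
  mx_deriv_within J P t
    (pair_derivation C *m P t + P t *m (pair_derivation C)^T) ->
  forall i j k l, has_deriv_within J (fun s => minor2 (G s) i j k l) t
    (Y i k * G t j l + G t i k * Y j l - (Y i l * G t j k + G t i l * Y j k)).
Proof.
move=> G P Y uE PD i j k l.
pose W s i j k l := dual_pair_mx (P s) (mxtens_index (i, j)) (mxtens_index (k, l)).
pose W' i j k l := - \sum_m (W t i j m l * C m k + W t i j k m * C m l
  + (C m i * W t m j k l + C m j * W t i m k l)).
have WD a b c d : has_deriv_within J (fun s => W s a b c d) t (W' a b c d).
  have h := dual_pair_form_deriv _ _ uE PD (mxtens_index (a, b)) (mxtens_index (c, d)).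
  rewrite mxE [X in - X]mxE mul_pair_derivationE pair_derivation_mulE in h.
  rewrite -big_split /= in h; move: h; congr (has_deriv_within _ _ _ (- _)).
  by apply: eq_bigr => m _; rewrite ![C^T _ _]mxE.
have NE s a b c d : J s ->
    minor2 (G s) a b c d = 2 * W s a b c d - W s b c a d - W s c a b d.
  by move=> Js; rewrite /minor2 (dual_pair_form_cyclic _ _ _ _ _ (uE s Js)).
have h := has_deriv_withinD _ _ _ _ _ _ (has_deriv_withinD _ _ _ _ _ _
  (has_deriv_withinZ _ _ 2 _ _ (WD i j k l))
  (has_deriv_withinN _ _ Jt _ _ (WD j k i l)))
  (has_deriv_withinN _ _ Jt _ _ (WD k i j l)).
have {}h := has_deriv_within_eq _ _ Jt _ _ _ (fun s Js => esym (NE s i j k l Js)) h.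
move: h; congr (has_deriv_within _ _ _ _).
(* The minors obey the same derivation equation as [W]. *)
transitivity (- \sum_m (C m i * minor2 (G t) m j k l + C m j * minor2 (G t) i m k l
  + C m k * minor2 (G t) i j m l + C m l * minor2 (G t) i j k m)).
  rewrite /W' mulrN !opprK mulr_sumr -!sumrN -!big_split /=.
  by apply: eq_bigr => m _; rewrite !NE //; ring.
have YE a b : Y a b = - \sum_m (C m a * G t m b + G t a m * C m b).
  rewrite /Y mxE mxE !mxE -big_split /=; congr (- _).
  by apply: eq_bigr => m _; rewrite mxE.
rewrite !YE !mulNr !mulrN opprD !opprK !mulr_suml !mulr_sumr -!sumrN -!big_split /=.
by apply: eq_bigr => m _; rewrite /minor2; ring.
Qed.

End MetricDerivative.

(** * Injectivity of the linearized minors *)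

Lemma minor2_linearization_inj (K : numFieldType) n (G Z : 'M[K]_n) :
  (2 < n)%N -> G \in unitmx ->
  (forall i j k l,
    Z i k * G j l + G i k * Z j l - (Z i l * G j k + G i l * Z j k) = 0) ->
  Z = 0.
Proof.
move=> n2 uG Z0; pose H := invmx G.
have trGH : \tr (G *m H) = n%:R by rewrite mulmxV // mxtrace1.
have trE (A : 'M[K]_n) : \tr (A *m H) = \sum_j \sum_l A j l * H l j.
  by apply: eq_bigr => j _; rewrite mxE.
(* Contracting [j] and [l] with [H] leaves [(n - 2) Z + tr(Z H) G = 0]. *)
have contraction : n%:R *: Z + \tr (Z *m H) *: G - (Z + Z) = 0.
  apply/matrixP => i k; rewrite [RHS]mxE.
  have ZHG : \sum_j \sum_l Z i l * G j k * H l j = Z i k.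
    rewrite -[in RHS](mulmxKV uG Z) mxE; apply: eq_bigr => j _.
    by rewrite mxE big_distrl; apply: eq_bigr => l _; rewrite /= mulrAC.
  have GHZ : \sum_j \sum_l G i l * Z j k * H l j = Z i k.
    rewrite -[in RHS](mulKVmx uG Z) mulmxA mxE; apply: eq_bigr => j _.
    by rewrite mxE big_distrl; apply: eq_bigr => l _; rewrite /= mulrAC.
  transitivity (Z i k * (\sum_j \sum_l G j l * H l j)
    + G i k * (\sum_j \sum_l Z j l * H l j)
    - (\sum_j \sum_l Z i l * G j k * H l j + \sum_j \sum_l G i l * Z j k * H l j)).
    rewrite ZHG GHZ -!trE trGH; set z := \tr _.
    by rewrite [LHS]mxE [X in X + _]mxE [X in X + _ + _]mxE
      [X in _ + X + _]mxE [X in _ + X]mxE [X in - X]mxE; ring.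
  rewrite !big_distrr -!big_split -sumrB big1 // => j _.
  rewrite !big_distrr /= -!big_split -sumrB big1 // => l _.
  transitivity ((Z i k * G j l + G i k * Z j l
    - (Z i l * G j k + G i l * Z j k)) * H l j); last by rewrite Z0 mul0r.
  rewrite /=; ring.
(* A second contraction gives [2 (n - 1) tr(Z H) = 0]. *)
have tr0 : \tr (Z *m H) = 0.
  have /(congr1 (fun A => \tr (A *m H))) := contraction.
  rewrite mul0mx mxtrace0 mulmxBl !mulmxDl -!scalemxAl linearB !linearD !linearZ /=.
  rewrite trGH; set z := \tr _ => /eqP.
  rewrite [X in X == 0](_ : _ = (n%:R - 1) * z *+ 2); last by ring.
  rewrite mulrn_eq0 mulf_eq0 /= subr_eq0 pnatr_eq1 => /orP[/eqP n1|/eqP //].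
  by rewrite n1 in n2.
move: contraction; rewrite tr0 scale0r addr0 -mulr2n -(scaler_nat 2 Z) -scalerBl.
move=> /eqP; rewrite scaler_eq0 subr_eq0 eqr_nat => /orP[/eqP n2'|/eqP //].
by rewrite n2' in n2.
Qed.

(** * The evolution of the metric *)

Lemma metric_deriv_within (R : realType) (J : set R) (t : R)
    (Phi : R -> @comp4 R 8) (g : R -> 'M[R]_8) (A : 'M[R]_8) :
  J t -> (forall s, J s -> spin7_metric (Phi s) (g s)) ->
  (forall i j k l : 'I_8, has_deriv_within J (fun s => Phi s i j k l) t
    (\sum_(m < 8) \sum_(n < 8)
      (A i m * invmx (g t) m n * Phi t n j k l
       + A j m * invmx (g t) m n * Phi t i n k l
       + A k m * invmx (g t) m n * Phi t i j n l
       + A l m * invmx (g t) m n * Phi t i j k n))) ->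
  mx_deriv_within J g t (A + A^T).
Proof.
move=> Jt Phig flow.
(* If [t] is isolated in [J], every limit holds; otherwise the filter is proper and derivatives are
   unique. *)
have [J0|/proper_within PF] := pselect (within J t^' set0).
  by move=> i j; exact: has_deriv_within_isolated.
(* The coframes are chosen time by time, with no continuity in [s]: only the form and the inverse
   metric built from them are differentiated. Outside [J] the value 0 is a placeholder. *)
have /choice[E Eg] : forall s, exists E, J s ->
    adapted_coframe (Phi s) E /\ g s = coframe_metric E.
  move=> s; have [Js|nJs] := pselect (J s); last by exists 0.
  by have [E hE] := Phig s Js; exists E.
have uE s : J s -> E s \in unitmx by move=> /Eg[[]].
have PhiE s : J s -> Phi s = spin7_form (E s) by move=> /Eg[[]].
have gE s : J s -> g s = coframe_metric (E s) by move=> /Eg[].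
pose G s := invmx (coframe_metric (E s)).
have GE s : J s -> G s = invmx (E s) *m (invmx (E s))^T.
  by move=> /uE; exact: invmx_coframe_metric.
have GT s : J s -> (G s)^T = G s by move=> /GE ->; rewrite trmx_mul trmxK.
have uG s : J s -> G s \in unitmx.
  by move=> Js; rewrite GE // unitmx_mul unitmx_tr unitmx_inv uE.
have n2 : (2 < 8)%N by [].
(* Raising the second index of [A] turns the flow into the derivation by [C] on the four slots of
   the form. *)
pose C := A *m G t.
pose P s := pair_mx (spin7_form (E s)).
have PD : mx_deriv_within J P t
    (pair_derivation C *m P t + P t *m (pair_derivation C)^T).
  move=> u v; case: (mxtens_indexP u) => i j; case: (mxtens_indexP v) => k l.
  have Pf s : J s -> Phi s i j k l = P s (mxtens_index (i, j)) (mxtens_index (k, l)).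
    by move=> Js; rewrite pair_mxE PhiE.
  apply: (has_deriv_within_eq _ _ Jt _ _ _ Pf); move: (flow i j k l).
  congr (has_deriv_within _ _ _ _).
  rewrite mxE pair_derivation_mulE trmx_pair_derivation mul_pair_derivationE.
  rewrite -big_split exchange_big /=; apply: eq_bigr => n _.
  rewrite !pair_mxE ![C^T _ _]mxE ![C _ _]mxE PhiE // gE // -/(G t).
  rewrite !big_distrl !big_distrr /= -!big_split /=; apply: eq_bigr => m _.
  ring.
pose Y : 'M[R]_8 := - (C^T *m G t + G t *m C).
have minorD i j k l : has_deriv_within J (fun s => minor2 (G s) i j k l) t
    (Y i k * G t j l + G t i k * Y j l - (Y i l * G t j k + G t i l * Y j k)).
  exact: (minor2_deriv _ _ Jt _ _ uE PD).
have GF s : J s -> exists2 F, F \in unitmx & G s = F *m F^T.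
  by move=> Js; exists (invmx (E s)); rewrite ?unitmx_inv ?uE ?GE.
have Gd : forall i j, exists D, has_deriv_within J (fun s => G s i j) t D.
  apply: (gram_derivable_of_minors _ _ _ _ _ n2 Jt GF) => i j k l.
  by eexists; exact: minorD.
pose D : 'M[R]_8 := \matrix_(i, j) projT1 (cid (Gd i j)).
have GD : mx_deriv_within J G t D.
  by move=> i j; rewrite mxE; case: (cid _).
(* The product rule with [D] and [minorD] with [Y] differentiate the same minors, so the
   linearization vanishes at [D - Y]. *)
have DY : D = Y.
  apply/eqP; rewrite -subr_eq0; apply/eqP.
  apply: (minor2_linearization_inj _ _ _ _ n2 (uG t Jt)) => i j k l.
  have h := has_deriv_withinD _ _ _ _ _ _
    (has_deriv_withinM _ _ _ _ _ _ (GD i k) (GD j l))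
    (has_deriv_withinN _ _ Jt _ _
      (has_deriv_withinM _ _ _ _ _ _ (GD i l) (GD j k))).
  have /eqP := has_deriv_within_unique _ _ _ _ _ PF h (minorD i j k l).
  have BE a b : (D - Y) a b = D a b - Y a b by rewrite mxE [X in _ + X]mxE.
  by rewrite !BE -subr_eq0 => /eqP <-; ring.
(* As [g] inverts [G], its derivative is [- g Y g], and [Y = - G (A^T + A) G]. *)
have gD := mx_deriv_within_invmx _ _ _ _ _ _ Jt uG GD.
move=> i j; have h := gD i j.
have gG s : J s -> invmx (G s) i j = g s i j.
  by move=> Js; rewrite invmxK gE.
have {}h := has_deriv_within_eq _ _ Jt _ _ _ gG h.
move: h; congr (has_deriv_within _ _ _ (_ i j)).
have CE : C^T *m G t + G t *m C = G t *m (A^T + A) *m G t.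
  by rewrite /C trmx_mul GT // mulmxDr mulmxDl !mulmxA.
rewrite DY /Y mulmxN mulNmx opprK CE !mulmxA mulVmx ?uG // mul1mx.
by rewrite mulmxK ?uG // addrC.
Qed.

Theorem proposition3p1 (R : realType) (M : smooth_manifold R 8) (J : set R)
    (Phi : R -> field4 M) (g h X : R -> field2 M)
    (J_interval : is_interval J)
    (Phi_spin7 : spin7_family J Phi)
    (g_metric : forall t a p, J t -> chart_dom (atlas a) p ->
       spin7_metric (Phi t a p) (g t a p))
    (h_smooth : forall t, J t -> smooth_tensor2 (h t))
    (h_sym : forall t a p, J t -> chart_dom (atlas a) p ->
       (h t a p)^T = h t a p)
    (X_smooth : forall t, J t -> smooth_tensor2 (X t))
    (X_Omega2_7 : forall t a p, J t -> chart_dom (atlas a) p ->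
       Omega2_7 (Phi t a p) (X t a p))
    (flow : forall t a p, J t -> chart_dom (atlas a) p -> forall i j k l : 'I_8,
       let A := h t a p + X t a p in
       let ginv := invmx (g t a p) in
       let F := Phi t a p in
       has_deriv_within J (fun s => Phi s a p i j k l) t
         (\sum_(m < 8) \sum_(n < 8)
            (A i m * ginv m n * F n j k l + A j m * ginv m n * F i n k l
             + A k m * ginv m n * F i j n l + A l m * ginv m n * F i j k n))) :
  forall t a p, J t -> chart_dom (atlas a) p -> forall i j : 'I_8,
    has_deriv_within J (fun s => g s a p i j) t (2 * h t a p i j).
Proof.
move=> t a p Jt pa.
have gD := metric_deriv_within _ J t (fun s => Phi s a p) (fun s => g s a p)
  (h t a p + X t a p) Jt (fun s Js => g_metric s a p Js pa) (flow t a p Jt pa).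
move=> i j; move: (gD i j); congr (has_deriv_within _ _ _ _).
(* [h] is symmetric and [X] antisymmetric, so [A + A^T = 2 h]. *)
rewrite linearD /= h_sym // (X_Omega2_7 t a p Jt pa).1 addrACA subrr addr0.
by rewrite mxE mulr_natl mulr2n.
Qed.
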